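(* We have (a) $$\frac{1}{1-t}+\sum_{n=1}^\infty\frac{(1+yt)^n}{(1-t)^{n+1}}P_n^{(\mathrm{lpk},\mathrm{des},\mathrm{fix})}\left(\frac{(1+y)^2t}{(y+t)(1+yt)},\frac{y+t}{1+yt},z\right)x^n=\sum_{k=0}^\infty\frac{(1+zxy)^k}{(1-zx)^{k+1}}\frac{(1-x)^{k+1}}{(1+xy)^k}\frac{t^k}{1-(k(1+y)+1)x}$$ and (b) $$\frac{1}{1-t}+\sum_{n=1}^\infty\frac{(1+yt)^n}{(1-t)^{n+1}}D_n^{(\mathrm{lpk},\mathrm{des})}\left(\frac{(1+y)^2t}{(y+t)(1+yt)},\frac{y+t}{1+yt}\right)x^n=\sum_{k=0}^\infty\frac{(1-x)^{k+1}}{(1+xy)^k}\frac{t^k}{1-(k(1+y)+1)x}.$$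
   Context: For a permutation $\pi=\pi(1)\cdots\pi(n)$ of $[n]=\{1,\dots,n\}$, $\mathrm{des}(\pi)$ is the number of descents, i.e. $i\in[n-1]$ with $\pi(i)>\pi(i+1)$; an index $i\in[n-1]$ is a left peak if either $2\le i\le n-1$ and $\pi(i-1)<\pi(i)>\pi(i+1)$, or $i=1$ and $\pi(1)>\pi(2)$, and $\mathrm{lpk}(\pi)$ is the number of left peaks; $\mathrm{fix}(\pi)$ is the number of fixed points. $\mathfrak{S}_n$ is the set of all permutations of $[n]$ and $\mathfrak{D}_n$ is the set of derangements of $[n]$ (permutations with no fixed points). Put $$P_n^{(\mathrm{lpk},\mathrm{des},\mathrm{fix})}(y,t,z)=\sum_{\pi\in\mathfrak{S}_n}y^{\mathrm{lpk}(\pi)}t^{\mathrm{des}(\pi)}z^{\mathrm{fix}(\pi)},\qquad D_n^{(\mathrm{lpk},\mathrm{des})}(y,t)=\sum_{\pi\in\mathfrak{D}_n}y^{\mathrm{lpk}(\pi)}t^{\mathrm{des}(\pi)}.$$ The identities are between formal power series in $x$ and $t$; rational functions of $y,t$ are expanded as power series in $t$. *)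

(* Defs.v *)
From HB Require Import structures.
From mathcomp Require Import all_boot all_algebra perm.
From mathcomp Require Import boolp.

Set Implicit Arguments.
Unset Strict Implicit.
Unset Printing Implicit Defensive.

Import GRing.Theory.
Local Open Scope ring_scope.

Record fps (R : Type) := Fps { fps_coef : nat -> R }.

Declare Scope fps_scope.
Delimit Scope fps_scope with fps.
Notation "f [@ n ]" := (fps_coef f n)
  (at level 2, left associativity, format "f [@ n ]") : fps_scope.
Local Open Scope fps_scope.

HB.instance Definition _ (R : Type) := gen_eqMixin (fps R).
HB.instance Definition _ (R : Type) := gen_choiceMixin (fps R).

Lemma fpsP (R : Type) (f g : fps R) : (forall n, f[@n] = g[@n]) -> f = g.
Proof. by case: f g => [f] [g] /= /funext ->. Qed.

Section Ring.
Variable R : comNzRingType.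
Implicit Types f g h : fps R.

Definition fps_zero : fps R := Fps (fun=> 0).
Definition fps_opp f : fps R := Fps (fun n => - f[@n]).
Definition fps_add f g : fps R := Fps (fun n => f[@n] + g[@n]).
Definition fpsC (c : R) : fps R := Fps (fun n => if n == 0%N then c else 0).
Definition fpsX : fps R := Fps (fun n => (n == 1%N)%:R).
Definition fps_mul f g : fps R :=
  Fps (fun n => \sum_(i < n.+1) f[@i] * g[@(n - i)]).

Fact fps_addA : associative fps_add.
Proof. by move=> f g h; apply: fpsP => n /=; rewrite addrA. Qed.
Fact fps_addC : commutative fps_add.
Proof. by move=> f g; apply: fpsP => n /=; rewrite addrC. Qed.
Fact fps_add0 : left_id fps_zero fps_add.
Proof. by move=> f; apply: fpsP => n /=; rewrite add0r. Qed.
Fact fps_addN : left_inverse fps_zero fps_opp fps_add.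
Proof. by move=> f; apply: fpsP => n /=; rewrite addNr. Qed.

HB.instance Definition _ :=
  GRing.isZmodule.Build (fps R) fps_addA fps_addC fps_add0 fps_addN.

Let trunc N f : {poly R} := \poly_(i < N) f[@i].

Let coef_trunc2 N n f g : (n < N)%N ->
  (trunc N f * trunc N g)`_n = (fps_mul f g)[@n].
Proof.
move=> ltnN; rewrite coefM; apply: eq_bigr => i _; rewrite !coef_poly.
by rewrite (leq_trans (ltn_ord i)) // (leq_ltn_trans (leq_subr _ _)).
Qed.

Let coefM_eq (p p' q q' : {poly R}) n :
  (forall i, (i <= n)%N -> p`_i = p'`_i) ->
  (forall i, (i <= n)%N -> q`_i = q'`_i) -> (p * q)`_n = (p' * q')`_n.
Proof.
move=> ep eq; rewrite !coefM; apply: eq_bigr => i _.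
by rewrite ep -1?ltnS // eq // leq_subr.
Qed.

Fact fps_mulC : commutative fps_mul.
Proof.
by move=> f g; apply: fpsP => n; rewrite -!(@coef_trunc2 n.+1) // mulrC.
Qed.

Fact fps_mulA : associative fps_mul.
Proof.
move=> f g h; apply: fpsP => n; rewrite -!(@coef_trunc2 n.+1) //.
pose p := trunc n.+1 f; pose q := trunc n.+1 g; pose r := trunc n.+1 h.
rewrite (@coefM_eq _ p _ (q * r)) //; last first.
  by move=> i lein; rewrite coef_poly ltnS lein -(@coef_trunc2 n.+1).
rewrite mulrA; apply: coefM_eq => // i lein.
by rewrite coef_poly ltnS lein -(@coef_trunc2 n.+1).
Qed.

Fact fps_mul1 : left_id (fpsC 1) fps_mul.
Proof.
move=> f; apply: fpsP => n /=; rewrite big_ord_recl subn0 mul1r big1 ?addr0 //.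
by move=> i _; rewrite /= mul0r.
Qed.

Fact fps_mulDl : left_distributive fps_mul fps_add.
Proof.
move=> f g h; apply: fpsP => n /=; rewrite -big_split.
by apply: eq_bigr => i _; rewrite mulrDl.
Qed.

Fact fps_oner_neq0 : fpsC 1 != 0.
Proof.
by apply/eqP => /(congr1 (fun f => f[@0])) /eqP; rewrite /= oner_eq0.
Qed.

HB.instance Definition _ := GRing.Zmodule_isComNzRing.Build (fps R)
  fps_mulA fps_mulC fps_mul1 fps_mulDl fps_oner_neq0.

Lemma fps_coef0 n : (0 : fps R)[@n] = 0. Proof. by []. Qed.
Lemma fps_coefN f n : (- f)[@n] = - f[@n]. Proof. by []. Qed.
Lemma fps_coefD f g n : (f + g)[@n] = f[@n] + g[@n]. Proof. by []. Qed.
Lemma fps_coef1 n : (1 : fps R)[@n] = (n == 0%N)%:R.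
Proof. by rewrite /=; case: (n == 0%N). Qed.
Lemma fps_coefM f g n : (f * g)[@n] = \sum_(i < n.+1) f[@i] * g[@(n - i)].
Proof. by []. Qed.
Lemma fps_coef_sum I r (P : pred I) (F : I -> fps R) n :
  (\sum_(i <- r | P i) F i)[@n] = \sum_(i <- r | P i) (F i)[@n].
Proof. by elim/big_rec2: _ => // i x y _ <-. Qed.

Fact fps_coefX_eq0 f n m : f[@0] = 0 -> (m < n)%N -> (f ^+ n)[@m] = 0.
Proof.
move=> f0; elim: n m => // n IHn m ltmn; rewrite exprS fps_coefM big1 // => i _.
have [->|i_gt0] := posnP i; first by rewrite f0 mul0r.
have i_lem : (i <= m)%N by rewrite -ltnS.
rewrite IHn ?mulr0 //; rewrite ltnS in ltmn; apply: leq_trans ltmn.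
by rewrite ltn_subrL i_gt0 (leq_trans i_gt0 i_lem).
Qed.

End Ring.

Section UnitRing.
Variable R : comUnitRingType.
Implicit Types f g h : fps R.

Definition fps_unit : pred (fps R) := fun f => f[@0] \is a GRing.unit.

(* If a = f[@0] is a unit then f^-1 = a^-1 \sum_k (1 - a^-1 f)^k, and the terms
   k > n do not contribute to the coefficient of index n. *)
Definition fps_inv f : fps R :=
  if fps_unit f then
    fpsC (f[@0])^-1 *
    Fps (fun n => (\sum_(k < n.+1) (1 - fpsC (f[@0])^-1 * f) ^+ k)[@n])
  else f.

Fact fps_mulVr : {in fps_unit, left_inverse 1 fps_inv *%R}.
Proof.
move=> f uf; rewrite /fps_inv; have uf' : fps_unit f by [].
rewrite uf'; set a := fpsC _; set s := Fps _.
pose h := 1 - a * f.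
have h0 : h[@0] = 0.
  by rewrite /h fps_coefD fps_coefN fps_coefM big_ord1 /= mulVr // subrr.
rewrite mulrC mulrA [f * a]mulrC.
have -> : a * f = 1 - h by rewrite /h opprB addrC subrK.
have sE n N : (n <= N)%N -> s[@n] = (\sum_(k < N.+1) h ^+ k)[@n].
  move=> lenN; rewrite /= !fps_coef_sum.
  rewrite (big_ord_widen_cond N.+1 predT (fun k => (h ^+ k)[@n])) //=.
  rewrite big_mkcond; apply: eq_bigr => k _; case: ltnP => //= ltnk.
  by rewrite fps_coefX_eq0.
apply: fpsP => n; transitivity (((1 - h) * \sum_(k < n.+1) h ^+ k)[@n]).
  by rewrite !fps_coefM; apply: eq_bigr => i _; rewrite (sE _ n) ?leq_subr.
rewrite -opprB mulNr -subrX1 opprB fps_coefD fps_coefN.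
by rewrite fps_coefX_eq0 // subr0.
Qed.

Fact fps_unitPl f g : g * f = 1 -> fps_unit f.
Proof.
move=> /(congr1 (fun h => h[@0])); rewrite fps_coefM big_ord1 /= => gf1.
by apply/unitrPr; exists (g[@0]); rewrite mulrC.
Qed.

Fact fps_invr_out : {in [predC fps_unit], fps_inv =1 id}.
Proof.
by move=> f; rewrite inE /= /fps_inv => /negbTE uf; rewrite ifF.
Qed.

HB.instance Definition _ := GRing.ComNzRing_hasMulInverse.Build (fps R)
  fps_mulVr fps_unitPl fps_invr_out.

Lemma fps_unitE f : (f \is a GRing.unit) = (f[@0] \is a GRing.unit).
Proof. by []. Qed.

End UnitRing.

(* [fps (fps R)] is R[[t]][[x]]: the outer variable is x, the inner one is t. *)
Section DoubleSeries.
Variable R : comNzRingType.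

(* \sum_(k >= m) F k = S coefficientwise, every coefficient of the partial sums
   being eventually constant. *)
Definition fps2_sum (m : nat) (F : nat -> fps (fps R)) (S : fps (fps R)) :=
  forall i j, exists N, forall M, (N <= M)%N ->
    (\sum_(m <= k < M) F k)[@i][@j] = S[@i][@j].

Lemma fps2_sum_unique m F S S' : fps2_sum m F S -> fps2_sum m F S' -> S = S'.
Proof.
move=> FS FS'; apply: fpsP => i; apply: fpsP => j.
have [[N eN] [N' eN']] := (FS i j, FS' i j).
by rewrite -(eN (maxn N N')) ?leq_maxl // -(eN' (maxn N N')) ?leq_maxr.
Qed.

End DoubleSeries.

(* The inverse of a non-unit is a junk value; all the denominators of interest
   are units when y is. *)
Lemma denominators_unit (R : comUnitRingType) (a b : R) :
  let x : fps (fps R) := fpsX (fps R) in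
  let t : fps (fps R) := fpsC (fpsX R) in
  let y := fpsC (fpsC a) in let z := fpsC (fpsC b) in
  a \is a GRing.unit ->
  [/\ 1 - t \is a GRing.unit, y + t \is a GRing.unit
    & 1 + y * t \is a GRing.unit] /\
  [/\ 1 - z * x \is a GRing.unit, 1 + x * y \is a GRing.unit
    & forall k, 1 - (k%:R * (1 + y) + 1) * x \is a GRing.unit].
Proof.
move=> x t y z ua.
have x0 (f : fps (fps R)) : (f * x)[@0] = 0.
  by rewrite fps_coefM big_ord1 /= mulr0.
have t0 (f : fps (fps R)) : (f * t)[@0][@0] = 0.
  by rewrite fps_coefM big_ord1 fps_coefM big_ord1 /= mulr0.
have t00 : t[@0][@0] = 0 by [].
split; split; try move=> k; rewrite !fps_unitE !(fps_coefD, fps_coefN, fps_coef1).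
- by rewrite t00 subr0 unitr1.
- by rewrite t00 addr0.
- by rewrite t0 addr0 unitr1.
- by rewrite x0 subr0 unitr1.
- by rewrite mulrC x0 addr0 unitr1.
- by rewrite x0 subr0 unitr1.
Qed.

(* Q(y,z), with z = 'X and y = 'X%:P. *)
Notation Qyz := {fraction {poly {poly rat}}}.

Definition sx : fps (fps Qyz) := fpsX (fps Qyz).
Definition st : fps (fps Qyz) := fpsC (fpsX Qyz).
Definition sy : fps (fps Qyz) := fpsC (fpsC (tofrac 'X%:P)).
Definition sz : fps (fps Qyz) := fpsC (fpsC (tofrac 'X)).

Lemma y_unit : (tofrac 'X%:P : Qyz) \is a GRing.unit.
Proof. by rewrite unitfE tofrac_eq0 polyC_eq0 polyX_eq0. Qed.

(* Indices and values of permutations are shifted by one: [n] is {0, ..., n-1}. *)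
Section Statistics.
Variable n : nat.
Implicit Types s : 'S_n.

Definition descent s (i : 'I_n) : bool :=
  [exists j : 'I_n, (j == i.+1 :> nat) && (s j < s i)%N].

Definition left_peak s (i : 'I_n) : bool :=
  descent s i &&
  ((i == 0 :> nat) || [exists h : 'I_n, (i == h.+1 :> nat) && (s h < s i)%N]).

Definition des s : nat := #|[set i | descent s i]|.
Definition lpk s : nat := #|[set i | left_peak s i]|.
Definition fix_ s : nat := #|[set i | s i == i]|.
Definition derangement s : bool := [forall i, s i != i].

End Statistics.

Definition P_lpk_des_fix (A : comNzRingType) (n : nat) (y t z : A) : A :=
  \sum_(s : 'S_n) y ^+ lpk s * t ^+ des s * z ^+ fix_ s.

Definition D_lpk_des (A : comNzRingType) (n : nat) (y t : A) : A :=
  \sum_(s : 'S_n | derangement s) y ^+ lpk s * t ^+ des s.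

(* Main.v *)
From HB Require Import structures.
Require Import Defs.
From mathcomp Require Import all_boot all_algebra perm.
From mathcomp Require Import zify ring.

(** Fix k and use the 2k+1 letters 0, ..., 2k; an even letter has weight 1 and
    an odd one, thought of as barred, has weight y.  A pair (s, a) consists of a
    permutation s and a weakly increasing word a such that s increases along
    every run of an even letter of a and decreases along every run of an odd
    one.  The coefficient of t^k on both sides of the identity is the sum of
    z^fix(s) x^n times the weights of the letters, over all such pairs.  Three
    facts establish this.

    - Left-hand side.  For fixed s the number of words a depends only on the
      descents of s, and can be computed letter by letter.  In terms of
      generating functions in t, the step from one position to the next is a
      2 x 2 matrix of rank one, so that the total is a product of one factor
      for each pair of consecutive ascents or descents: 1 + yt, t(1 + y),
      y + t and 1 + y.  As left peaks are the places where an ascent is followed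
      by a descent, this product is the left-hand term
      (lemma series_thru_closed).

    - Right-hand side at z = 1.  Removing the largest value of s and its letter
      is a bijection onto pairs of size n - 1 together with a letter, because
      the largest value can only be inserted at the end of the run of its
      letter (even) or at the beginning of it (odd).  Hence the pairs of size n
      have total weight (k(1 + y) + 1)^n (lemma pair_sum_unweighted).

    - Dependence on z.  A fixed point of s can be removed without spoiling the
      conditions, the other fixed points remaining fixed.  Conversely, within
      the run of an even letter s(i) - i is weakly increasing, so that fixed
      points with this letter, in any number, can only be inserted where
      s(i) - i changes sign; in the run of an odd letter s(i) - i is strictly
      decreasing, so that it can host at most one fixed point, again at a
      unique place.  Treating the letters one after the other (lemmas
      pair_sum_even and pair_sum_odd), every even letter contributes a factor
      1/(1 - zx) and every odd one a factor 1 + zxy, and what remains is the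
      sum over derangements, which is eliminated by comparison with z = 1
      (lemmas fixed_point_series, unmarked_series and outer_series).

    Part (b) is the case z = 0 of part (a), valid for any z. *)

Set Implicit Arguments.
Unset Strict Implicit.
Unset Printing Implicit Defensive.

Import GRing.Theory.
Local Open Scope ring_scope.
Local Open Scope fps_scope.

(** * Permutations with compatible labellings *)

(** Whether letter l2 can follow letter l1, according to whether the permutation
    has an ascent there; the same condition is then imposed on all pairs of
    positions, which makes it stable under deletion of a position. *)
Definition admissible (l1 l2 : nat) (asc : bool) : bool :=
  (l1 < l2)%N || ((l1 == l2) && (odd l1 != asc)).

Definition compatible n (f a : 'I_n -> nat) : bool :=
  [forall i : 'I_n, forall j : 'I_n,
     (i < j)%N ==> admissible (a i) (a j) (f i < f j)%N].

Local Notation pair_compatible s a :=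
  (compatible (fun i => s i) (fun i => a i)).

Lemma compatibleP n (f a : 'I_n -> nat) :
  reflect
    (forall i j : 'I_n, (i < j)%N -> admissible (a i) (a j) (f i < f j)%N)
    (compatible f a).
Proof.
apply: (iffP forallP) => [h i j ij|h i].
  by have /forallP/(_ j)/implyP/(_ ij) := h i.
by apply/forallP => j; apply/implyP; apply: h.
Qed.

Definition insert n N (j : 'I_n.+1) (b : 'I_N) (a : {ffun 'I_n -> 'I_N}) :
  {ffun 'I_n.+1 -> 'I_N} := [ffun i => oapp a b (unlift j i)].

Lemma insert_id n N (j : 'I_n.+1) (b : 'I_N) a : insert j b a j = b.
Proof. by rewrite ffunE unlift_none. Qed.

Lemma insert_lift n N (j : 'I_n.+1) (b : 'I_N) a i :
  insert j b a (lift j i) = a i.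
Proof. by rewrite ffunE liftK. Qed.

Lemma ltn_lift n (j : 'I_n.+1) (i i' : 'I_n) :
  (lift j i < lift j i')%N = (i < i')%N.
Proof. by rewrite !ltnNge /= leq_bump2. Qed.

Lemma lift_ltn n (j : 'I_n.+1) (i : 'I_n) : (lift j i < j)%N = (i < j)%N.
Proof. by rewrite /= /bump; lia. Qed.

Lemma ltn_lift_r n (j : 'I_n.+1) (i : 'I_n) :
  (j < lift j i)%N = (j <= i)%N.
Proof. by rewrite /= /bump; lia. Qed.

(** The conditions that involve a new entry at position j, of value p and with
    letter b, the other positions and values being shifted to make room. *)
Definition insertable n (f a : 'I_n -> nat) (j p : 'I_n.+1) (b : nat) : bool :=
  [forall i : 'I_n, if (i < j)%N then admissible (a i) b (f i < p)%N
                    else admissible b (a i) (p <= f i)%N].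

Local Notation pair_insertable s a :=
  (insertable (fun i => s i) (fun i => a i)).

Lemma compatible_lift n N (s : 'S_n) (a : {ffun 'I_n -> 'I_N})
    (j p : 'I_n.+1) b :
  pair_compatible (lift_perm j p s) (insert j b a) =
  pair_compatible s a && pair_insertable s a j p b.
Proof.
apply/compatibleP/andP => [h|[/compatibleP h /forallP hl] i i'].
  split.
    apply/compatibleP => i i' ii'.
    have := h (lift j i) (lift j i').
    by rewrite ltn_lift !insert_lift !lift_perm_lift ltn_lift; apply.
  apply/forallP => i; case: ltnP => ij.
    have := h (lift j i) j.
    rewrite lift_ltn insert_lift insert_id lift_perm_lift lift_perm_id lift_ltn.
    exact.
  have := h j (lift j i).
  rewrite ltn_lift_r insert_lift insert_id lift_perm_lift lift_perm_id.
  by rewrite ltn_lift_r; apply.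
case: (unliftP j i) => [k|] ->; case: (unliftP j i') => [k'|] ->.
- by rewrite ltn_lift !insert_lift !lift_perm_lift ltn_lift; apply: h.
- rewrite lift_ltn insert_lift insert_id lift_perm_lift lift_perm_id lift_ltn.
  by move=> kj; have := hl k; rewrite kj.
- rewrite ltn_lift_r insert_lift insert_id lift_perm_lift lift_perm_id.
  by rewrite ltn_lift_r => jk; have := hl k'; rewrite ltnNge jk.
- by rewrite ltnn.
Qed.

Section Sums.
Variable R : comNzRingType.

Lemma sum_lift_perm n (j p : 'I_n.+1) (F : 'S_n.+1 -> R) :
  \sum_(s : 'S_n.+1 | s j == p) F s = \sum_s F (lift_perm j p s).
Proof.
have lift_perm_inj : injective (lift_perm j p).
  move=> s1 s2 /permP eqs; apply/permP => i; apply: (@lift_inj _ p).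
  by rewrite -!(lift_perm_lift j); apply: eqs.
have lift_perm_onto (s : 'S_n.+1) : s j = p -> exists s', lift_perm j p s' = s.
  move=> sj; have ex i : exists k, lift p k == s (lift j i).
    have /unlift_some[k -> _] : p != s (lift j i).
      by rewrite -sj (inj_eq perm_inj) neq_lift.
    by exists k.
  have sK i : lift p (xchoose (ex i)) = s (lift j i) := eqP (xchooseP (ex i)).
  have inj_s : injective (fun i => xchoose (ex i)).
    move=> i i' /(congr1 (lift p)); rewrite !sK.
    by move/perm_inj/lift_inj.
  exists (perm inj_s); apply/permP => i.
  case: (unliftP j i) => [k|] ->; last by rewrite lift_perm_id sj.
  by rewrite lift_perm_lift permE sK.
rewrite (reindex (lift_perm j p)); last first.
  exists (fun s => odflt 1%g [pick s' | lift_perm j p s' == s]) => s.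
    by case: pickP => [s' /eqP/lift_perm_inj|/(_ s)]; rewrite ?eqxx.
  rewrite inE => /eqP/lift_perm_onto[s0 eqs0].
  by case: pickP => [s' /eqP|/(_ s0)]; rewrite ?eqs0 ?eqxx.
by apply: eq_bigl => s; rewrite lift_perm_id eqxx.
Qed.

Lemma sum_perm_by_preimage n (p : 'I_n.+1) (F : 'S_n.+1 -> R) :
  \sum_s F s = \sum_j \sum_s F (lift_perm j p s).
Proof.
rewrite (partition_big (fun s : 'S_n.+1 => (s^-1)%g p) predT) //=.
apply: eq_bigr => j _; rewrite -sum_lift_perm; apply: eq_bigl => s.
by rewrite (canF_eq (permKV s)) eq_sym.
Qed.

Lemma sum_insert n N (j : 'I_n.+1) (b : 'I_N)
    (P : pred {ffun 'I_n.+1 -> 'I_N}) (F : {ffun 'I_n.+1 -> 'I_N} -> R) :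
  \sum_(a | P a && (a j == b)) F a =
  \sum_(a | P (insert j b a)) F (insert j b a).
Proof.
rewrite (reindex (insert j b)).
  by apply: eq_bigl => a; rewrite insert_id eqxx andbT.
exists (fun a : {ffun 'I_n.+1 -> 'I_N} => [ffun i => a (lift j i)]) => [a _|a].
  by apply/ffunP => i; rewrite ffunE insert_lift.
rewrite inE => /andP[_ /eqP ajb]; apply/ffunP => i; rewrite ffunE.
by case: (unliftP j i) => [k|] -> /=; rewrite ?ffunE ?ajb.
Qed.

Lemma sum_by_letter n N (j : 'I_n.+1)
    (P : pred {ffun 'I_n.+1 -> 'I_N}) (F : {ffun 'I_n.+1 -> 'I_N} -> R) :
  \sum_(a | P a) F a = \sum_b \sum_(a | P (insert j b a)) F (insert j b a).
Proof.
rewrite (partition_big (fun a : {ffun 'I_n.+1 -> 'I_N} => a j) predT) //=.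
by apply: eq_bigr => b _; rewrite sum_insert.
Qed.

(** An initial segment of positions has exactly one end: this is what makes the
    place of insertion unique, the entries in P being those that must precede
    the new one. *)
Lemma sum_cut n (P : pred 'I_n) (x : R) :
  (forall i i' : 'I_n, (i < i')%N -> P i' -> P i) ->
  \sum_(j < n.+1 | [forall i : 'I_n, (i < j)%N == P i]) x = x.
Proof.
move=> Pdown.
have card_lt (j : 'I_n.+1) : #|[pred i : 'I_n | (i < j)%N]| = j.
  rewrite -sum1_card (eq_bigl (fun i : 'I_n => (i < j)%N)) //.
  by rewrite -(big_ord_widen n (fun=> 1%N)) ?sum1_card ?card_ord // -ltnS.
have cardP : (#|P| < n.+1)%N by rewrite ltnS -[n in leqRHS]card_ord max_card.
rewrite (big_pred1 (Ordinal cardP)) // => j /=.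
apply/forallP/eqP => [h|->] /=.
  apply/val_inj; rewrite /= -[LHS]card_lt; apply: eq_card => i.
  by rewrite inE (eqP (h i)).
move=> i; apply/eqP; apply/idP/idP => [/=|Pi].
  apply: contraLR => nPi; rewrite -leqNgt.
  have <- : #|[pred k : 'I_n | (k < i)%N]| = i.
    exact: card_lt (widen_ord (leqnSn n) i).
  apply: subset_leq_card; apply/subsetP => k; rewrite unfold_in inE => Pk.
  rewrite ltnNge leq_eqVlt; apply/negP => /predU1P[/val_inj ik|/Pdown/(_ Pk)].
    by rewrite ik Pk in nPi.
  by apply/negP.
have <- : #|[pred k : 'I_n | (k < i.+1)%N]| = i.+1.
  exact: card_lt (lift ord0 i).
apply: subset_leq_card; apply/subsetP => k.
rewrite inE unfold_in ltnS leq_eqVlt.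
by case/predU1P => [/val_inj ->//|/Pdown/(_ Pi)].
Qed.

Lemma sum_first n (Q : pred 'I_n) (x : R) :
  \sum_(j < n | Q j && [forall i : 'I_n, (i < j)%N ==> ~~ Q i]) x =
  if [exists j, Q j] then x else 0.
Proof.
case: existsP => [[j0 Qj0]|nQ]; last first.
  by apply: big1 => j /andP[Qj _]; case: nQ; exists j.
case: (arg_minnP (fun i : 'I_n => i : nat) Qj0) => m Qm minm.
rewrite (big_pred1 m) // => j; apply/andP/eqP => [[Qj /forallP h]|->].
  apply/val_inj/eqP; rewrite eqn_leq minm // andbT leqNgt.
  by apply/negP => mj; have := h m; rewrite mj Qm.
split=> //; apply/forallP => i; apply/implyP => im; apply/negP => /minm.
by rewrite leqNgt im.
Qed.

(** The weight w distinguishes fixed points from other entries with the same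
    letter, so that it can mark or forbid fixed points letter by letter. *)
Definition pair_sum (w : bool -> nat -> R) n N : R :=
  \sum_(s : 'S_n) \sum_(a : {ffun 'I_n -> 'I_N} | pair_compatible s a)
    \prod_i w (s i == i) (a i).

End Sums.

(** * Where a new entry can be inserted *)

Section Insertion.
Variables (n N : nat) (s : 'S_n) (a : {ffun 'I_n -> 'I_N}).
Hypothesis sa : pair_compatible s a.

Lemma compatible_adm (i j : 'I_n) :
  (i < j)%N -> admissible (a i) (a j) (s i < s j)%N.
Proof. by move/compatibleP: sa; apply. Qed.

Lemma compatible_mono (i j : 'I_n) : (i <= j)%N -> (a i <= a j)%N.
Proof.
rewrite leq_eqVlt => /predU1P[/val_inj ->//|/compatible_adm].
by rewrite /admissible; lia.
Qed.

Lemma compatible_block (c i j : 'I_n) :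
  (i <= c <= j)%N -> a i = a j -> a c = a i.
Proof.
move=> /andP[ic cj] aij; apply/val_inj/eqP.
by rewrite eqn_leq (compatible_mono ic) aij compatible_mono.
Qed.

Lemma compatible_odd (i j : 'I_n) :
  (i < j)%N -> a i = a j -> odd (a i) = (s j < s i)%N.
Proof.
move=> ij aij; have := compatible_adm ij.
rewrite /admissible aij ltnn eqxx /=.
have : s i != s j :> nat.
  by apply: contraTneq ij => /val_inj/perm_inj->; rewrite ltnn.
lia.
Qed.

(** In other words, s i - i is weakly increasing along the run of an even
    letter. *)
Lemma even_block_gap (i j : 'I_n) :
  (i <= j)%N -> a i = a j -> ~~ odd (a i) ->
  (s i + (j - i) <= s j)%N.
Proof.
case: j => j; elim: j => [|j IHj] ltjn.
  rewrite leqn0 => /eqP i0 _ _.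
  by rewrite (_ : i = Ordinal ltjn) ?subnn ?addn0 //; apply/val_inj.
rewrite leq_eqVlt => /predU1P[/val_inj ->|/= ltij aij ev].
  by rewrite subnn addn0.
pose j' := Ordinal (ltnW ltjn).
have aij' : a j' = a i.
  by apply: (compatible_block _ aij) => /=; rewrite -ltnS ltij leqnSn.
have := IHj (ltnW ltjn) ltij (esym aij') ev.
have := @compatible_odd j' (Ordinal ltjn) (leqnn _) (etrans aij' aij).
rewrite aij' (negbTE ev) /= => h.
have : s j' != s (Ordinal ltjn) :> nat.
  by apply/eqP => /val_inj/perm_inj/(congr1 val) /=; lia.
rewrite -/j'; lia.
Qed.

(** The largest value makes an ascent with everything on its left and a descent
    with everything on its right, so that it belongs at the end of the run of
    its letter if this is even, and at the beginning if it is odd. *)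
Lemma insertable_max (j : 'I_n.+1) (b : 'I_N) :
  pair_insertable s a j ord_max b =
  [forall i : 'I_n, (i < j)%N == (a i < b + ~~ odd b)%N].
Proof.
apply: eq_forallb => i; rewrite /admissible /= (ltn_ord (s i)).
rewrite [in (n <= _)%N]leqNgt ltn_ord; case: ltnP => _; lia.
Qed.

Variable c : 'I_N.

Definition fixed_at (i : 'I_n) := (s i == i) && (a i == c).

(** Entries of the run of c lying to the left of a new fixed point must have
    s i < i and those to the right s i >= i; the second condition says
    that the new fixed point is the first one with letter c. *)
Lemma insertable_even (j : 'I_n.+1) : ~~ odd c ->
  pair_insertable s a j j c &&
     [forall i : 'I_n, (i < j)%N ==> ~~ fixed_at i] =
  [forall i : 'I_n,
     (i < j)%N == ((a i < c) || (a i == c) && (s i < i))%N].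
Proof.
move=> ev; apply/andP/forallP => [[/forallP ins /forallP nfix] i|h].
  have := ins i; have := nfix i; rewrite /fixed_at.
  case: ltnP => [ij|ji] /= nf; rewrite /admissible.
    case/orP => [->//|/andP[/eqP/val_inj aic _]].
    rewrite aic eqxx andbT in nf *.
    suff : (s i <= i)%N.
      rewrite leq_eqVlt -(inj_eq val_inj) in nf *.
      by rewrite (negbTE nf) => /= ->; rewrite orbT.
    (* The last entry on the left has s j' <= j', hence so has entry i. *)
    have lt0j : (j.-1 < n)%N by have := ltn_ord j; lia.
    pose j' := Ordinal lt0j.
    have := ins j'; rewrite ifT /=; last lia.
    have ij' : (i <= j')%N by rewrite /=; lia.
    have := compatible_mono ij'; rewrite aic => cj'.
    rewrite /admissible ltnNge cj' /= => /andP[/eqP/val_inj aj'c].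
    have := @even_block_gap i j' ij'; rewrite aic aj'c ev => /(_ erefl isT) /=.
    lia.
  case/orP => [ci|/andP[/eqP/val_inj cai]].
    by rewrite -(inj_eq val_inj) /=; lia.
  rewrite -cai ltnn eqxx /= => jsi.
  (* Here the first entry on the right has s j' >= j', hence so has entry i. *)
  have ltjn : (j < n)%N := leq_ltn_trans ji (ltn_ord i).
  pose j' := Ordinal ltjn.
  have := ins j'; rewrite ltnn.
  have := @compatible_mono j' i ji; rewrite -cai => cj'.
  rewrite /admissible ltnNge cj' /= => /andP[/eqP/val_inj aj'c].
  have := @even_block_gap j' i ji; rewrite -aj'c -cai ev => /(_ erefl isT) /=.
  lia.
split; apply/forallP => i; have := h i;
  rewrite /admissible /fixed_at -!(inj_eq val_inj) /=; case: ltnP; lia.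
Qed.

(** Entries of the run of c lying to the left of a new fixed point must have
    s i > i and those to the right s i < i, so that no other fixed point with
    letter c is possible.  That these signs are sufficient is seen by looking at
    the entry at position s i, which would violate the decrease of s along the
    run if the new fixed point were not between i and s i. *)
Lemma insertable_odd (j : 'I_n.+1) : odd c ->
  pair_insertable s a j j c &&
     [forall i : 'I_n, (i < j)%N ==> ~~ fixed_at i] =
  [forall i : 'I_n,
     (i < j)%N == ((a i < c) || (a i == c) && (i < s i))%N]
  && ~~ [exists i, fixed_at i].
Proof.
move=> od; apply/andP/andP => [[/forallP ins nfix]|[/forallP h /existsPn nfix]].
  split; last first.
    apply/existsPn => i; have := ins i.
    rewrite /fixed_at /admissible -!(inj_eq val_inj) /=.
    case: ltnP; lia.
  apply/forallP => i; have := ins i; rewrite /admissible -!(inj_eq val_inj) /=.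
  case: ltnP; lia.
split; last by apply/forallP => i; rewrite nfix implybT.
apply/forallP => i; have := h i; have := nfix i; rewrite /fixed_at /admissible.
have := h (s i); rewrite -!(inj_eq val_inj) /=.
have := @compatible_mono i (s i); have := @compatible_mono (s i) i.
have := @compatible_odd i (s i); have := @compatible_odd (s i) i.
move=> h1 h2.
have {}h1 : (s i < i)%N -> a i = a (s i) :> nat ->
    odd (a (s i)) = (s i < s (s i))%N.
  by move=> ? ?; apply: h1 => //; apply/val_inj.
have {}h2 : (i < s i)%N -> a i = a (s i) :> nat ->
    odd (a i) = (s (s i) < s i)%N.
  by move=> ? ?; apply: h2 => //; apply/val_inj.
case: (ltnP (s i) j) => ?; case: (ltnP i j) => ?; lia.
Qed.

End Insertion.

(** * Recurrences for sums over compatible pairs *)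

Section Recurrences.
Variable R : comNzRingType.
Implicit Type w : bool -> nat -> R.

Lemma pair_sum0 w N : pair_sum w 0 N = 1.
Proof.
rewrite /pair_sum (big_pred1 (1%g : 'S_0)); last first.
  by move=> s; apply/esym/eqP/permP => -[].
rewrite (big_pred1 [ffun i : 'I_0 => False_rect _ (notF (ltn_ord i))]).
  by rewrite big_ord0.
move=> a; rewrite inE /=; apply/compatibleP/eqP => [_|_ []//].
by apply/ffunP => -[].
Qed.

(** Pairs of size n correspond to arbitrary words of length n: induction on n by
    removal of the largest value, whose letter b is arbitrary. *)
Lemma pair_sum_unweighted (w0 : nat -> R) n N :
  pair_sum (fun=> w0) n N = (\sum_(b < N) w0 b : R) ^+ n.
Proof.
elim: n => [|n IHn]; first by rewrite pair_sum0.
rewrite exprS -IHn /pair_sum (sum_perm_by_preimage ord_max).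
rewrite exchange_big /= mulr_sumr.
apply: eq_bigr => s _.
transitivity (\sum_(j < n.+1) \sum_(b < N)
   \sum_(a : {ffun 'I_n -> 'I_N} | pair_compatible s a &&
      [forall i : 'I_n, (i < j)%N == (a i < b + ~~ odd b)%N])
     w0 b * \prod_i w0 (a i)).
  apply: eq_bigr => j _; rewrite (sum_by_letter j); apply: eq_bigr => b _.
  apply: eq_big => a.
    by rewrite compatible_lift; apply: andb_id2l => sa; rewrite insertable_max.
  move=> _; rewrite (bigD1_ord j) //= insert_id; congr (_ * _).
  by apply: eq_bigr => i _; rewrite insert_lift.
rewrite exchange_big /= mulr_suml; apply: eq_bigr => b _; rewrite mulr_sumr.
rewrite (exchange_big_dep
  (fun a : {ffun 'I_n -> 'I_N} => pair_compatible s a)) /=.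
  apply: eq_bigr => a sa; rewrite (eq_bigl (fun j : 'I_n.+1 =>
    [forall i : 'I_n, (i < j)%N == (a i < b + ~~ odd b)%N])); last first.
    by move=> j; rewrite sa.
  rewrite sum_cut // => i i' /ltnW/(compatible_mono sa) h1 h2.
  exact: leq_ltn_trans h1 h2.
by move=> j a _ /andP[].
Qed.

Lemma pair_sum_forbid w w' (c : nat) n N :
  (forall l, w' false l = w false l) ->
  (forall l, w' true l = if l == c then 0 else w true l) ->
  forall (s : 'S_n) (a : {ffun 'I_n -> 'I_N}),
  \prod_i w' (s i == i) (a i) =
  if [exists i, (s i == i) && (a i == c :> nat)] then 0
  else \prod_i w (s i == i) (a i).
Proof.
move=> wF wT s a; case: existsP => [[i /andP[si ai]]|nfix].
  by rewrite (bigD1 i) //= si wT ai mul0r.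
apply: eq_bigr => i _; case: eqP => // /eqP si; rewrite wT ifN //.
by apply/negP => ai; case: nfix; exists i; rewrite si.
Qed.

(** A pair that has fixed points with letter c is determined by the first of
    them, at position j, and by what is left after its removal. *)
Lemma pair_sum_first_fixed w w' (N : nat) (c : 'I_N) n :
  (forall l, w' false l = w false l) ->
  (forall l, w' true l = if l == c then 0 else w true l) ->
  pair_sum w n.+1 N = pair_sum w' n.+1 N + w true c *
   \sum_(s : 'S_n) \sum_(a : {ffun 'I_n -> 'I_N}) \sum_(j < n.+1 |
      [&& pair_compatible s a,
          pair_insertable s a j j c &
          [forall i : 'I_n, (i < j)%N ==> ~~ fixed_at s a c i]])
   \prod_i w (s i == i) (a i).
Proof.
move=> wF wT.
transitivity (pair_sum w' n.+1 N + \sum_(s : 'S_n.+1)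
   \sum_(a : {ffun 'I_n.+1 -> 'I_N} | pair_compatible s a)
   \sum_(j < n.+1 | fixed_at s a c j &&
                   [forall i : 'I_n.+1, (i < j)%N ==> ~~ fixed_at s a c i])
   \prod_i w (s i == i) (a i)).
  rewrite /pair_sum -big_split; apply: eq_bigr => s _ /=; rewrite -big_split /=.
  apply: eq_bigr => a _; rewrite (pair_sum_forbid wF wT) sum_first /fixed_at.
  by case: ifP => _; rewrite ?add0r ?addr0.
congr (_ + _).
transitivity (\sum_(j < n.+1) \sum_(s : 'S_n.+1 | s j == j)
   \sum_(a : {ffun 'I_n.+1 -> 'I_N} | pair_compatible s a &&
            [forall i : 'I_n.+1, (i < j)%N ==> ~~ fixed_at s a c i] &&
            (a j == c)) \prod_i w (s i == i) (a i)).
  under [RHS]eq_bigr do rewrite big_mkcond.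
  rewrite [RHS]exchange_big; apply: eq_bigr => s _ /=.
  rewrite (exchange_big_dep predT) //=; apply: eq_bigr => j _.
  case: eqP => sj.
    apply: eq_bigl => a; rewrite /fixed_at sj eqxx /= -andbA; congr (_ && _).
    exact: andbC.
  by apply: big_pred0 => a; rewrite /fixed_at (introF eqP sj) andbF.
rewrite mulr_sumr; under [RHS]eq_bigr do rewrite mulr_sumr.
under [RHS]eq_bigr do under eq_bigr do rewrite big_mkcond mulr_sumr.
under [RHS]eq_bigr do rewrite exchange_big /=.
rewrite [RHS]exchange_big /=; apply: eq_bigr => j _.
rewrite sum_lift_perm; apply: eq_bigr => s _.
rewrite sum_insert big_mkcond; apply: eq_bigr => a _ /=.
rewrite compatible_lift -andbA.
have -> : [forall i : 'I_n.+1, (i < j)%N ==>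
             ~~ fixed_at (lift_perm j j s) (insert j c a) c i] =
  [forall i : 'I_n, (i < j)%N ==> ~~ fixed_at s a c i].
  apply/forallP/forallP => h i.
    have := h (lift j i).
    rewrite /fixed_at lift_ltn lift_perm_lift insert_lift.
    by rewrite (inj_eq lift_inj).
  case: (unliftP j i) => [k|] ->; last by rewrite ltnn.
  rewrite /fixed_at lift_ltn lift_perm_lift insert_lift (inj_eq lift_inj).
  exact: h.
case: ifP => _; last by rewrite mulr0.
rewrite (bigD1_ord j) //= lift_perm_id insert_id eqxx; congr (_ * _).
by apply: eq_bigr => i _; rewrite lift_perm_lift insert_lift (inj_eq lift_inj).
Qed.

(** With an even letter c the place of the first fixed point is forced whatever
    remains, even if further fixed points with letter c remain: hence w, and not
    w', in the last term. *)
Lemma pair_sum_even w w' (N : nat) (c : 'I_N) n :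
  (forall l, w' false l = w false l) ->
  (forall l, w' true l = if l == c then 0 else w true l) -> ~~ odd c ->
  pair_sum w n.+1 N = pair_sum w' n.+1 N + w true c * pair_sum w n N.
Proof.
move=> wF wT ev; rewrite (pair_sum_first_fixed n wF wT); congr (_ + _ * _).
apply: eq_bigr => s _; rewrite [RHS]big_mkcond; apply: eq_bigr => a _ /=.
case: ifP => sa; last by rewrite big_pred0 // => j; rewrite sa.
under eq_bigl do rewrite insertable_even //=.
rewrite sum_cut // => i i' ltii'.
have := compatible_mono sa (ltnW ltii').
have := even_block_gap sa (ltnW ltii').
rewrite -!(inj_eq val_inj) /= => h1 h2.
case/orP => [?|/andP[/eqP aic ?]]; first by apply/orP; left; lia.
case: (ltngtP (a i) c) => //= e; first lia.
have {}h1 := h1 (val_inj (etrans e (esym aic))).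
have : (s i + (i' - i) <= s i')%N by apply: h1; rewrite e.
lia.
Qed.

(** With an odd letter c a fixed point can be inserted, at a unique place, if
    and only if there is none yet: hence w' in the last term. *)
Lemma pair_sum_odd w w' (N : nat) (c : 'I_N) n :
  (forall l, w' false l = w false l) ->
  (forall l, w' true l = if l == c then 0 else w true l) -> odd c ->
  pair_sum w n.+1 N = pair_sum w' n.+1 N + w true c * pair_sum w' n N.
Proof.
move=> wF wT od; rewrite (pair_sum_first_fixed n wF wT); congr (_ + _ * _).
apply: eq_bigr => s _; rewrite [RHS]big_mkcond; apply: eq_bigr => a _ /=.
rewrite (pair_sum_forbid wF wT).
case: ifP => sa; last by rewrite big_pred0 // => j; rewrite sa.
under eq_bigl do rewrite insertable_odd //=.
case: ifP => _; first by rewrite big_pred0 // => j; rewrite andbF.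
under eq_bigl do rewrite andbT.
rewrite sum_cut // => i i' ltii'.
have := compatible_mono sa (ltnW ltii').
have := compatible_odd sa ltii'.
rewrite -!(inj_eq val_inj) /= => h1 h2.
case/orP => [?|/andP[/eqP aic ?]]; first by apply/orP; left; lia.
case: (ltngtP (a i) c) => //= e; first lia.
have {}h1 := h1 (val_inj (etrans e (esym aic))).
lia.
Qed.

End Recurrences.

(** * Power series and the labellings of a fixed permutation *)

Section Series.
Variable R : comNzRingType.
Implicit Types F G : fps R.

Lemma coef_fpsXM F n : (fpsX R * F)[@n] = if n is m.+1 then F[@m] else 0.
Proof.
rewrite fps_coefM; case: n => [|n]; first by rewrite big_ord1 /= mul0r.
rewrite (bigD1 (lift ord0 ord0)) //= mul1r subn1 big1 ?addr0 // => i ne.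
have -> : ((i : nat) == 1%N) = false.
  by apply: contraNF ne => /eqP i1; apply/eqP/val_inj.
by rewrite mul0r.
Qed.

Lemma coef_fpsCM c F n : (fpsC c * F)[@n] = c * F[@n].
Proof.
rewrite fps_coefM big_ord_recl subn0 big1 ?addr0 //= => i _.
by rewrite mul0r.
Qed.

Lemma coef_fpsXnM k F n :
  (fpsX R ^+ k * F)[@n] = if (k <= n)%N then F[@(n - k)] else 0.
Proof.
elim: k n => [|k IHk] n; first by rewrite mul1r subn0.
by rewrite exprS -mulrA coef_fpsXM; case: n => [|n] //; rewrite IHk.
Qed.

Lemma fpsC_is_additive : zmod_morphism (@fpsC R).
Proof.
move=> c d; apply: fpsP => n /=.
by case: (n == 0%N); rewrite ?subr0 ?oppr0 ?addr0.
Qed.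

Lemma fpsC_is_multiplicative : GRing.monoid_morphism (@fpsC R).
Proof.
split=> // c d; apply: fpsP => n; rewrite coef_fpsCM /=.
by case: (n == 0%N); rewrite ?mulr0.
Qed.

HB.instance Definition _ := GRing.isZmodMorphism.Build R (fps R) (@fpsC R)
  fpsC_is_additive.
HB.instance Definition _ := GRing.isMonoidMorphism.Build R (fps R) (@fpsC R)
  fpsC_is_multiplicative.

Lemma fps_geometric (a b : R) F :
  F[@0] = a -> (forall n, F[@n.+1] = b * F[@n]) ->
  (1 - fpsC b * fpsX R) * F = fpsC a.
Proof.
move=> F0 FS; apply: fpsP => n; rewrite mulrBl mul1r -mulrA fps_coefD fps_coefN.
rewrite coef_fpsCM coef_fpsXM.
by case: n => [|n] /=; rewrite ?mulr0 ?subr0 // FS subrr.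
Qed.

End Series.

Section LetterCount.
Variables (R : comNzRingType) (y : R) (f : nat -> nat).

(** Whether there is a descent just before position n.  Position 0 counts as
    preceded by an ascent, whence a descent just after it is a left peak. *)
Definition descends n := (0 < n)%N && (f n <= f n.-1)%N.

(** The number, weighted by y, of words of length n in the letters l < L that
    are compatible with f.  If the last letter is l, the previous letters may be
    smaller than l, or equal to l when the parity of l allows it: they are then
    bounded by l + 1.  The empty word counts as ending with the letter 0. *)
Fixpoint count_below n L : R :=
  if n is m.+1 then
    \sum_(l < L) y ^+ odd l * count_below m (l + (odd l == descends m))%N
  else (0 < L)%N%:R.

(** Because admissibility is transitive along a compatible word, only the last
    of its letters matters for an extension. *)
Lemma admissible_extension n (a : 'I_n -> nat) b :
  compatible (fun i : 'I_n => f i) a ->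
  [forall i : 'I_n, admissible (a i) b (f i < f n)%N] =
  [forall i : 'I_n, (a i < b + (odd b == descends n))%N].
Proof.
case: n a => [|n] a; first by move=> _; apply: eq_forallb => -[].
move=> /compatibleP ca; rewrite /descends /=.
have cmax (i : 'I_n.+1) :
    i = ord_max \/ admissible (a i) (a ord_max) (f i < f n)%N.
  case: (ltngtP i n) => [lt|gt|e].
  - by right; apply: (ca i ord_max).
  - by have := ltn_ord i; lia.
  by left; apply/val_inj.
apply/forallP/forallP => h i.
  have := h i; have := h ord_max.
  by case: (cmax i) => [-> /=|]; rewrite /admissible /=; lia.
have := h i; have := h ord_max.
by case: (cmax i) => [-> /=|]; rewrite /admissible /=; lia.
Qed.

Lemma sum_compatible_below n N L : (L <= N)%N -> (0 < n)%N || (0 < L)%N ->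
  \sum_(a : {ffun 'I_n -> 'I_N} |
          compatible (fun i : 'I_n => f i) (fun i => a i)
          && [forall i, (a i < L)%N]) \prod_i y ^+ odd (a i) =
  count_below n L.
Proof.
elim: n L => [|n IHn] L LN nL.
  rewrite /= in nL *; rewrite nL.
  rewrite (big_pred1 [ffun i : 'I_0 => False_rect _ (notF (ltn_ord i))]).
    by rewrite big_ord0.
  move=> a; rewrite inE /=; apply/andP/eqP => [_|_].
    by apply/ffunP => -[].
  by split; [apply/compatibleP => -[] | apply/forallP => -[]].
rewrite (sum_by_letter ord_max) /= (big_ord_widen N (fun l =>
  y ^+ odd l * count_below n (l + (odd l == descends n))%N)) //.
rewrite [RHS]big_mkcond; apply: eq_bigr => b _.
case: ltnP => bL; last first.
  rewrite big_pred0 // => a; apply/negbTE/negP => /andP[_ /forallP/(_ ord_max)].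
  by rewrite insert_id ltnNge bL.
case: (boolP ((0 < n) || (0 < b + (odd b == descends n)))%N) => [nb|];
  last first.
  by rewrite negb_or /descends; case: (n) => [|?]; case: (nat_of_ord b).
rewrite -IHn //; last by have := ltn_ord b; case: (odd b == _); lia.
rewrite mulr_sumr; apply: eq_big => [a|a _]; last first.
  rewrite (bigD1_ord ord_max) //= insert_id; congr (_ * _).
  by apply: eq_bigr => i _; rewrite insert_lift.
have -> :
    compatible (fun i : 'I_n.+1 => f i) (fun i => insert ord_max b a i) =
    compatible (fun i : 'I_n => f i) (fun i => a i) &&
    [forall i : 'I_n, admissible (a i) b (f i < f n)%N].
  apply/compatibleP/andP => [h|[/compatibleP h /forallP hb] i i'].
    split.
      apply/compatibleP => i i' ii'.
      have := h (lift ord_max i) (lift ord_max i').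
      by rewrite !insert_lift !lift_max; apply.
    apply/forallP => i; have := h (lift ord_max i) ord_max.
    by rewrite insert_lift insert_id !lift_max; apply; apply: ltn_ord.
  case: (unliftP ord_max i) => [k|] ->; case: (unliftP ord_max i') => [k'|] ->.
  - by rewrite !insert_lift !lift_max; apply: h.
  - by rewrite insert_lift insert_id lift_max => _; apply: hb.
  - by rewrite lift_max => kn; have := ltn_trans kn (ltn_ord k'); rewrite ltnn.
  - by rewrite ltnn.
rewrite -andbA; apply: andb_id2l => ca; rewrite admissible_extension //.
apply/andP/forallP => [[/forallP h _] //|h]; split; first exact/forallP.
apply/forallP => i.
case: (unliftP ord_max i) => [k|] ->; last by rewrite insert_id.
by rewrite insert_lift; have := h k; case: (odd b == _); lia.
Qed.

(** The coefficient of index k counts words in the letters 0, ..., 2k, and below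
    in the letters 0, ..., 2k - 1. *)
Definition series_thru n : fps R := Fps (fun k => count_below n k.*2.+1).
Definition series_upto n : fps R := Fps (fun k => count_below n k.*2).

Let t := fpsX R.
Let Y := fpsC y.

Lemma series_thru0 : (1 - t) * series_thru 0 = 1.
Proof.
apply: fpsP => k; rewrite mulrBl mul1r fps_coefD fps_coefN coef_fpsXM fps_coef1.
by case: k => [|k] /=; rewrite ?subr0 ?subrr.
Qed.

Lemma count_below0 n : count_below n 0 = 0.
Proof. by case: n => //= n; rewrite big_ord0. Qed.

(** In each step both new series are multiples of the same old one: after an
    ascent all that matters is the number of words with letters up to 2k, and
    after a descent the number of those with letters up to 2k - 1. *)
Lemma series_thruS n : (1 - t) * series_thru n.+1 =
  if descends n then (1 + Y) * series_upto n else (1 + Y * t) * series_thru n.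
Proof.
apply: fpsP => k; rewrite mulrBl mul1r fps_coefD fps_coefN coef_fpsXM.
case: ifP => dn; rewrite mulrDl mul1r fps_coefD -?mulrA;
  rewrite coef_fpsCM ?coef_fpsXM /=.
  case: k => [|k].
    rewrite big_ord1 /= dn expr0 mul1r add0n !count_below0.
    by rewrite mulr0 subr0 addr0.
  rewrite doubleS 2!big_ord_recr /= odd_double dn /= addn0 addn1.
  by rewrite expr1 expr0 mul1r -!addrA; ring.
case: k => [|k].
  by rewrite big_ord1 /= dn expr0 mul1r add0n mulr0 subr0 addr0.
rewrite doubleS 2!big_ord_recr /= odd_double dn /= addn0 addn1.
by rewrite expr1 expr0 mul1r; ring.
Qed.

Lemma series_uptoS n : (1 - t) * series_upto n.+1 =
  if descends n then (Y + t) * series_upto n else t * (1 + Y) * series_thru n.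
Proof.
apply: fpsP => k; rewrite mulrBl mul1r fps_coefD fps_coefN coef_fpsXM.
case: ifP => dn; rewrite ?(mulrDr t) ?mulr1 mulrDl ?(mulrC t Y) -?mulrA;
  rewrite fps_coefD coef_fpsCM !coef_fpsXM.
  case: k => [|k].
    by rewrite /= big_ord0 !count_below0 mulr0 subr0 addr0.
  rewrite /= big_ord_recr big_ord_recr /= odd_double dn /= addn0 addn1.
  by rewrite expr1 expr0 mul1r; ring.
case: k => [|k]; first by rewrite /= big_ord0 mulr0 addr0 subr0.
rewrite /= big_ord_recr big_ord_recr /= odd_double dn /= addn0 addn1.
by rewrite expr1 expr0 mul1r; ring.
Qed.

End LetterCount.

(** * Descents and left peaks *)

Section Transfer.
Variables (R : comNzRingType) (y : R) (f : nat -> nat).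
Let t := fpsX R.
Let Y := fpsC y.
Variables (P T : fps R).
Hypothesis PE : P * ((Y + t) * (1 + Y * t)) = (1 + Y) ^+ 2 * t.
Hypothesis TE : T * (1 + Y * t) = Y + t.

Let d := descends f.
Let ndes n := (\sum_(i < n) d i)%N.
Let npeak n := (\sum_(i < n) (d i && ~~ d i.-1))%N.
Let value n := (1 + Y * t) ^+ n * (P ^+ npeak n * T ^+ ndes n).

(** The numbers 1 + Y and 1 + Y * t are the factors contributed by an ascent
    after a descent and after an ascent; including the factor for an ascent in
    the next place makes both cases equal to value, whose recurrence has one factor
    1 + Y * t for every position, one T for every descent, and one P for
    every left peak. *)
Lemma series_transfer n :
  (1 - t) ^+ n.+1 * (if d n then (1 + Y) * series_upto y f n
                     else (1 + Y * t) * series_thru y f n) = value n.+1.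
Proof.
have valueS m : value m.+1 =
    (1 + Y * t) * P ^+ (d m && ~~ d m.-1) * T ^+ d m * value m.
  by rewrite /value /npeak /ndes !big_ord_recr /= !exprD exprS; ring.
elim: n => [|n IHn].
  rewrite valueS /d /= expr1 mulrCA series_thru0.
  by rewrite /value /npeak /ndes !big_ord0; ring.
rewrite valueS -IHn /=; case: (boolP (d n.+1)) => dS.
  rewrite exprSr -mulrA (mulrCA (1 - t)) series_uptoS -/(d n) -/Y -/t.
  case: (d n) => /=; last first.
    transitivity ((1 - t) ^+ n.+1 * (((1 + Y) ^+ 2 * t) * series_thru y f n)).
      by ring.
    by rewrite -PE -TE; ring.
  by rewrite -TE; ring.
by rewrite exprSr -mulrA (mulrCA (1 - t)) series_thruS /= expr0 !mulr1 mulrCA.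
Qed.

Lemma series_thru_eval n :
  (1 - t) ^+ n.+1 * series_thru y f n = value n.
Proof.
case: n => [|n].
  by rewrite expr1 series_thru0 /value /npeak /ndes !big_ord0 !mulr1.
by rewrite exprSr -mulrA series_thruS series_transfer.
Qed.

End Transfer.

Section Permutations.
Variables (n : nat) (s : 'S_n).

(** The values of s as a function on all natural numbers, as required by
    count_below; only the values below n matter. *)
Definition values i : nat := if insub i is Some j then s j else 0.

Lemma valuesE (i : 'I_n) : values i = s i.
Proof. by rewrite /values valK. Qed.

Lemma descentE (i : 'I_n) :
  descent s i = (i.+1 < n)%N && descends values i.+1.
Proof.
apply/existsP/andP => [[j /andP[/eqP ji lt]]|[lt]].
  have lt' := ltn_ord j.
  by rewrite -ji lt' /descends ji /= -ji !valuesE ltnW.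
rewrite /descends /= (valuesE i) (valuesE (Ordinal lt)) => le.
exists (Ordinal lt); rewrite eqxx ltn_neqAle le andbT.
by apply/eqP => /val_inj/perm_inj/(congr1 val) /=; lia.
Qed.

Lemma left_peakE (i : 'I_n) :
  left_peak s i =
  (i.+1 < n)%N && (descends values i.+1 && ~~ descends values i).
Proof.
rewrite /left_peak descentE -andbA; congr (_ && (_ && _)).
rewrite [in RHS]/descends lt0n negb_and negbK -ltnNge.
case: (boolP (i == 0 :> nat)) => //= i0.
have lt : (i.-1 < n)%N by have := ltn_ord i; lia.
apply/existsP/idP => [[h /andP[/eqP ih]]|].
  by rewrite -!valuesE ih.
rewrite (valuesE i) (valuesE (Ordinal lt)) => ?.
by exists (Ordinal lt); apply/andP; split => //=; lia.
Qed.

Lemma card_shift (e : nat -> bool) : e 0 = false ->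
  #|[set i : 'I_n | (i.+1 < n)%N && e i.+1]| = (\sum_(i < n) e i)%N.
Proof.
move=> e0.
rewrite -sum1_card (eq_bigl (fun i : 'I_n => (i.+1 < n)%N && e i.+1));
  last first.
  by move=> i; rewrite inE.
rewrite big_mkcond; case: n => [|m]; first by rewrite !big_ord0.
rewrite big_ord_recr big_ord_recl /= ltnn e0 addn0 add0n.
by apply: eq_bigr => i _; rewrite /= ltnS ltn_ord; case: (e _).
Qed.

Lemma des_sum : des s = (\sum_(i < n) descends values i)%N.
Proof.
by rewrite -card_shift //; apply: eq_card => i; rewrite !inE descentE.
Qed.

Lemma lpk_sum : lpk s =
  (\sum_(i < n) (descends values i && ~~ descends values i.-1))%N.
Proof.
rewrite -(card_shift
  (e := fun i => descends values i && ~~ descends values i.-1)) //.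
by apply: eq_card => i; rewrite !inE left_peakE.
Qed.

Lemma series_thru_perm (R : comNzRingType) (y : R) k :
  (series_thru y values n)[@k] =
  \sum_(a : {ffun 'I_n -> 'I_k.*2.+1} | pair_compatible s a)
    \prod_i y ^+ odd (a i).
Proof.
rewrite /= -(@sum_compatible_below _ y values n k.*2.+1) ?orbT //.
apply: eq_bigl => a.
have -> : [forall i, (a i < k.*2.+1)%N].
  by apply/forallP => i; apply: ltn_ord.
rewrite andbT; apply/compatibleP/compatibleP => h i j;
  by have := h i j; rewrite !valuesE.
Qed.

End Permutations.

(** * Fixed points *)

Definition fixed_weight (R : comNzRingType) (y z : R)
    (fixed : bool) (l : nat) : R :=
  (if fixed then z else 1) * y ^+ odd l.

Lemma pair_sum_fix (R : comNzRingType) (y z : R) n k :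
  pair_sum (fixed_weight y z) n k.*2.+1 =
  \sum_(s : 'S_n) z ^+ fix_ s * (series_thru y (values s) n)[@k].
Proof.
apply: eq_bigr => s _; rewrite series_thru_perm mulr_sumr.
apply: eq_bigr => a _.
rewrite big_split /=; congr (_ * _).
rewrite -big_mkcond prodr_const /fix_; congr (_ ^+ _).
by apply: eq_card => i; rewrite inE.
Qed.

Lemma eq_pair_sum (R : comNzRingType) (w w' : bool -> nat -> R) n N :
  (forall b (l : 'I_N), w b l = w' b l) -> pair_sum w n N = pair_sum w' n N.
Proof.
move=> ww'; apply: eq_bigr => s _; apply: eq_bigr => a _.
by apply: eq_bigr => i _.
Qed.

Section FixedPointSeries.
Variables (R : comNzRingType) (y z : R) (k : nat).
Let x := fpsX R.
Let N := k.*2.+1.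

(** Fixed points with letters below m are forbidden; those with the other
    letters are still marked by z. *)
Let weight m (fixed : bool) (l : nat) : R :=
  (if fixed then if (l < m)%N then 0 else z else 1) * y ^+ odd l.
Let series m := Fps (fun n => pair_sum (weight m) n N).

Let weightT m l : weight m.+1 true l = if l == m then 0 else weight m true l.
Proof.
by rewrite /weight ltnS leq_eqVlt; case: eqP => //= _; rewrite mul0r.
Qed.

Let series_even m : (m < N)%N -> ~~ odd m ->
  (1 - fpsC z * x) * series m = series m.+1.
Proof.
move=> mN ev; apply: fpsP => n.
rewrite mulrBl mul1r -mulrA fps_coefD fps_coefN coef_fpsCM coef_fpsXM /=.
case: n => [|n]; first by rewrite !pair_sum0 mulr0 subr0.
rewrite (@pair_sum_even _ (weight m) (weight m.+1) N (Ordinal mN)) //.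
by rewrite {2}/weight /= ltnn (negbTE ev) mulr1 addrK.
Qed.

Let series_odd m : (m < N)%N -> odd m ->
  series m = (1 + fpsC z * x * fpsC y) * series m.+1.
Proof.
move=> mN od; apply: fpsP => n.
rewrite mulrDl mul1r (mulrAC (fpsC z)) -rmorphM -mulrA.
rewrite fps_coefD coef_fpsCM coef_fpsXM /=.
case: n => [|n]; first by rewrite !pair_sum0 mulr0 addr0.
rewrite (@pair_sum_odd _ (weight m) (weight m.+1) N (Ordinal mN)) //.
by rewrite {2}/weight /= ltnn od expr1.
Qed.

(** The letters 0, ..., 2k are treated in turn, and there are k + 1 even and k
    odd ones. *)
Lemma fixed_point_series :
  (1 - fpsC z * x) ^+ k.+1 * Fps (fun n => pair_sum (fixed_weight y z) n N) =
  (1 + fpsC z * x * fpsC y) ^+ k *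
  Fps (fun n => pair_sum (fixed_weight y 0) n N).
Proof.
have -> : Fps (fun n => pair_sum (fixed_weight y z) n N) = series 0.
  by apply: fpsP => n /=; apply: eq_pair_sum => b l.
have -> : Fps (fun n => pair_sum (fixed_weight y 0) n N) = series k.*2.+1.
  by apply: fpsP => n /=; apply: eq_pair_sum => b l; rewrite /weight ltn_ord.
suff: forall j, (j <= k)%N -> (1 - fpsC z * x) ^+ j.+1 * series 0 =
    (1 + fpsC z * x * fpsC y) ^+ j * series j.*2.+1 by apply.
elim=> [|j IHj] lejk; first by rewrite expr1 series_even // mul1r.
rewrite exprS -mulrA IHj 1?ltnW // series_odd ?oddS ?odd_double //;
  last by rewrite /N; lia.
rewrite mulrCA (mulrCA (1 - _)) series_even ?doubleS ?oddS ?odd_double //;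
  last by rewrite /N; lia.
by rewrite exprSr !mulrA.
Qed.

Lemma unmarked_series :
  (1 - (k%:R * (1 + fpsC y) + 1) * x) *
  Fps (fun n => pair_sum (fixed_weight y 1) n N) = 1.
Proof.
have total n :
    pair_sum (fixed_weight y 1) n N = (k%:R * (1 + y) + 1) ^+ n.
  rewrite (@eq_pair_sum _ _ (fun _ l => y ^+ odd l)); last first.
    by move=> b l; rewrite /fixed_weight; case: b; rewrite mul1r.
  rewrite (pair_sum_unweighted (fun l => y ^+ odd l)); congr (_ ^+ _).
  rewrite /N; elim: (k) => [|j IHj]; first by rewrite big_ord1 mul0r add0r.
  rewrite doubleS 2!big_ord_recr IHj /= odd_double /= expr1 expr0.
  by rewrite -[in RHS]natr1; ring.
have -> : k%:R * (1 + fpsC y) + 1 = fpsC (k%:R * (1 + y) + 1).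
  by rewrite rmorphD rmorphM rmorphD !rmorph1 rmorph_nat.
rewrite -[RHS](rmorph1 (@fpsC R)); apply: fps_geometric => [|n] /=.
  by rewrite total.
by rewrite !total exprS.
Qed.

End FixedPointSeries.

(** * The two sides of the identity *)

Lemma fps2_sum_outer (R : comNzRingType) (c : nat -> fps R) :
  fps2_sum 1 (fun n => fpsC (c n) * fpsX (fps R) ^+ n)
    (Fps (fun n => if n == 0%N then 0 else c n)).
Proof.
move=> i j; exists i.+1 => M iM; rewrite fps_coef_sum.
rewrite (eq_bigr (fun n => if n == i then c n else 0)) => [|n _]; last first.
  rewrite coef_fpsCM -[X in X[@i]]mulr1 coef_fpsXnM fps_coef1.
  rewrite subn_eq0 eqn_leq.
  by case: (leqP n i) => _ /=; case: (leqP i n) => _ /=; rewrite ?mulr1 ?mulr0.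
rewrite -big_mkcond /= big_nat_cond.
case: i iM => [|i] iM.
  by rewrite big1 // => n /andP[/andP[n0 _] /eqP n00]; rewrite n00 in n0.
rewrite (eq_bigl (fun n => (1 <= n < M)%N && (n == i.+1))) // -big_nat_cond.
by rewrite big_nat1_eq /= iM.
Qed.

Lemma fps2_sum_inner (R : comNzRingType) (h : nat -> nat -> R) :
  fps2_sum 0 (fun k => Fps (fun n => fpsC (h n k)) * fpsC (fpsX R) ^+ k)
    (Fps (fun n => Fps (h n))).
Proof.
move=> i j; exists j.+1 => M jM; rewrite !fps_coef_sum.
rewrite (eq_bigr (fun k => if k == j then h i k else 0)) => [|k _]; last first.
  rewrite mulrC -rmorphXn coef_fpsCM coef_fpsXnM /= subn_eq0 eqn_leq.
  by case: leqP => //= _; rewrite if_same.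
by rewrite -big_mkcond big_nat1_eq /= jM.
Qed.

Lemma pair_sum_fpsC (R : comNzRingType) (y z : R) n N :
  pair_sum (fixed_weight (fpsC y) (fpsC z)) n N =
  fpsC (pair_sum (fixed_weight y z) n N).
Proof.
rewrite rmorph_sum; apply: eq_bigr => s _.
rewrite rmorph_sum; apply: eq_bigr => a _.
rewrite rmorph_prod; apply: eq_bigr => i _.
rewrite /fixed_weight rmorphM rmorphXn.
by case: ifP => _; rewrite ?rmorph1.
Qed.

Lemma P_lpk_des_fixC (R : comNzRingType) n (y t z : R) :
  P_lpk_des_fix n (fpsC y) (fpsC t) (fpsC z) = fpsC (P_lpk_des_fix n y t z).
Proof.
by rewrite rmorph_sum; apply: eq_bigr => s _; rewrite !rmorphM !rmorphXn.
Qed.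

Lemma D_lpk_desE (R : comNzRingType) n (y t : R) :
  D_lpk_des n y t = P_lpk_des_fix n y t 0.
Proof.
rewrite /D_lpk_des big_mkcond; apply: eq_bigr => s _.
rewrite expr0n /fix_ cards_eq0; case: ifP => [/forallP ns|/negbT].
  have -> : [set i | s i == i] = set0.
    by apply/setP => i; rewrite !inE (negbTE (ns i)).
  by rewrite eqxx mulr1.
rewrite negb_forall => /existsP[i]; rewrite negbK => si.
have /negbTE-> : [set i | s i == i] != set0.
  by apply/set0Pn; exists i; rewrite inE.
by rewrite mulr0.
Qed.

Lemma eq_fps2_sum (R : comNzRingType) m (F G : nat -> fps (fps R)) S :
  F =1 G -> fps2_sum m G S -> fps2_sum m F S.
Proof.
move=> FG GS i j; have [N GN] := GS i j; exists N => M NM.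
by rewrite (eq_bigr G) ?GN.
Qed.

Section Main.
Variables (R : comUnitRingType) (y0 z0 : R).
Hypothesis y_unit : y0 \is a GRing.unit.

Let x : fps (fps R) := fpsX (fps R).
Let t : fps (fps R) := fpsC (fpsX R).
Let y : fps (fps R) := fpsC (fpsC y0).
Let z : fps (fps R) := fpsC (fpsC z0).

Let den := denominators_unit z0 y_unit.

(* The values of T and Y, as series in t alone. *)
Let T0 : fps R := (fpsC y0 + fpsX R) / (1 + fpsC y0 * fpsX R).
Let Y0 : fps R :=
  (1 + fpsC y0) ^+ 2 * fpsX R / ((fpsC y0 + fpsX R) * (1 + fpsC y0 * fpsX R)).

Let unit_1yt : 1 + fpsC y0 * fpsX R \is a GRing.unit.
Proof. by rewrite fps_unitE fps_coefD coef_fpsCM mulr0 addr0 unitr1. Qed.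

Let unit_yt : fpsC y0 + fpsX R \is a GRing.unit.
Proof. by rewrite fps_unitE fps_coefD /= addr0. Qed.

Let unit_1t : 1 - fpsX R \is a GRing.unit.
Proof. by rewrite fps_unitE fps_coefD fps_coefN /= subr0 unitr1. Qed.

Lemma series_thru_closed (f : nat -> nat) n :
  series_thru y0 f n =
  (1 + fpsC y0 * fpsX R) ^+ n / (1 - fpsX R) ^+ n.+1 *
    (Y0 ^+ (\sum_(i < n) (descends f i && ~~ descends f i.-1))%N *
     T0 ^+ (\sum_(i < n) descends f i)%N).
Proof.
apply: (mulrI (unitrX n.+1 unit_1t)).
rewrite (@series_thru_eval _ y0 f Y0 T0); first last.
- by rewrite divrK.
- by rewrite divrK // unitrM unit_yt.
by rewrite [(1 + _) ^+ n / _]mulrC -(mulrA (_ ^- _)) mulVKr ?unitrX.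
Qed.

Lemma inner_series n :
  (1 + fpsC y0 * fpsX R) ^+ n / (1 - fpsX R) ^+ n.+1 *
    P_lpk_des_fix n Y0 T0 (fpsC z0) =
  Fps (fun k => pair_sum (fixed_weight y0 z0) n k.*2.+1).
Proof.
rewrite mulr_sumr.
transitivity (\sum_(s : 'S_n)
  fpsC (z0 ^+ fix_ s) * series_thru y0 (values s) n).
  apply: eq_bigr => s _; rewrite rmorphXn series_thru_closed -lpk_sum -des_sum.
  by rewrite [RHS]mulrC -[RHS]mulrA.
apply: fpsP => k; rewrite fps_coef_sum [RHS]/= pair_sum_fix.
by apply: eq_bigr => s _; rewrite coef_fpsCM.
Qed.

(** The factor (1 + zxy)^k / (1 - zx)^(k+1) turns the series of derangements
    into that of all pairs; the series of derangements is itself obtained from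
    the geometric series at z = 1 by the inverse of the same factor. *)
Lemma outer_series k :
  (1 + z * x * y) ^+ k / (1 - z * x) ^+ k.+1
    * ((1 - x) ^+ k.+1 / (1 + x * y) ^+ k)
    * (t ^+ k / (1 - (k%:R * (1 + y) + 1) * x)) =
  Fps (fun n => fpsC (pair_sum (fixed_weight y0 z0) n k.*2.+1)) * t ^+ k.
Proof.
have [_ [uz uy /(_ k) uk]] := den.
have -> : Fps (fun n => fpsC (pair_sum (fixed_weight y0 z0) n k.*2.+1)) =
    Fps (fun n => pair_sum (fixed_weight (fpsC y0) (fpsC z0)) n k.*2.+1).
  by apply: fpsP => n /=; rewrite pair_sum_fpsC.
have Hz := fixed_point_series (fpsC y0) (fpsC z0) k.
have H1 := fixed_point_series (fpsC y0) 1 k.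
have Ht := unmarked_series (fpsC y0) k.
rewrite rmorph1 mul1r in H1.
have {}Ht := canRL (mulKr uk) Ht; rewrite mulr1 in Ht.
have {}Hz := canRL (mulKr (unitrX k.+1 uz)) Hz.
have {}H1 := canRL (mulKr (unitrX k uy)) (esym H1).
by rewrite Hz H1 Ht; ring.
Qed.

Theorem lpk_des_fix_series :
  let Y := (1 + y) ^+ 2 * t / ((y + t) * (1 + y * t)) in
  let T := (y + t) / (1 + y * t) in
  exists L S : fps (fps R),
    [/\ fps2_sum 1 (fun n =>
           (1 + y * t) ^+ n / (1 - t) ^+ n.+1
           * P_lpk_des_fix n Y T z * x ^+ n) L,
         fps2_sum 0 (fun k =>
           (1 + z * x * y) ^+ k / (1 - z * x) ^+ k.+1
           * ((1 - x) ^+ k.+1 / (1 + x * y) ^+ k)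
           * (t ^+ k / (1 - (k%:R * (1 + y) + 1) * x))) S
       & 1 / (1 - t) + L = S].
Proof.
move=> Y T.
pose c n := Fps (fun k => pair_sum (fixed_weight y0 z0) n k.*2.+1).
exists (Fps (fun n => if n == 0%N then 0 else c n)), (Fps c); split.
- apply: eq_fps2_sum (fps2_sum_outer c) => n; rewrite /c -inner_series.
  have eA : fpsC (1 + fpsC y0 * fpsX R) = 1 + y * t.
    by rewrite rmorphD rmorphM rmorph1.
  have eB : fpsC (fpsC y0 + fpsX R) = y + t by rewrite rmorphD.
  have eC : fpsC ((1 + fpsC y0) ^+ 2 * fpsX R) = (1 + y) ^+ 2 * t.
    by rewrite rmorphM rmorphXn rmorphD rmorph1.
  have eD : fpsC (1 - fpsX R) = 1 - t by rewrite rmorphB rmorph1.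
  rewrite /Y /T -eA -eB -eC -eD -rmorphM -!rmorphXn.
  rewrite -!rmorph_div ?unitrX ?unitrM ?unit_1yt ?unit_yt //=.
  by rewrite P_lpk_des_fixC -rmorphM.
- exact: eq_fps2_sum outer_series (fps2_sum_inner _).
(* The isolated term 1 / (1 - t) is the term n = 0 of the family. *)
have -> : 1 / (1 - t) = fpsC (c 0%N).
  rewrite /c -inner_series expr0 expr1 !mul1r /P_lpk_des_fix.
  rewrite (big_pred1 (1%g : 'S_0)) => [|s]; last by apply/esym/eqP/permP => -[].
  have stat0 (A : {set 'I_0}) : #|A| = 0%N by apply: eq_card0 => -[].
  by rewrite /lpk /des /fix_ !stat0 !mulr1 rmorphV // rmorphB rmorph1.
by apply: fpsP => -[|n] /=; rewrite ?addr0 ?add0r.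
Qed.

End Main.

Theorem lpk_des_derangement_series (R : comUnitRingType) (y0 : R) :
  y0 \is a GRing.unit ->
  let x : fps (fps R) := fpsX (fps R) in
  let t : fps (fps R) := fpsC (fpsX R) in
  let y : fps (fps R) := fpsC (fpsC y0) in
  let Y := (1 + y) ^+ 2 * t / ((y + t) * (1 + y * t)) in
  let T := (y + t) / (1 + y * t) in
  exists L S : fps (fps R),
    [/\ fps2_sum 1 (fun n =>
           (1 + y * t) ^+ n / (1 - t) ^+ n.+1
           * D_lpk_des n Y T * x ^+ n) L,
         fps2_sum 0 (fun k =>
           (1 - x) ^+ k.+1 / (1 + x * y) ^+ k
           * (t ^+ k / (1 - (k%:R * (1 + y) + 1) * x))) S
       & 1 / (1 - t) + L = S].
Proof.
move=> uy x t y Y T; have [L [S [HL HS LS]]] := lpk_des_fix_series 0 uy.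
have zero : fpsC (fpsC 0) = 0 :> fps (fps R) by rewrite !rmorph0.
exists L, S; split; last exact: LS.
  by apply: eq_fps2_sum HL => n; rewrite D_lpk_desE -zero.
apply: eq_fps2_sum HS => k.
by rewrite zero !mul0r addr0 subr0 !expr1n divr1 mul1r.
Qed.

Theorem theorem6p5 :
  let x := sx in let t := st in let y := sy in let z := sz in
  let Y := (1 + y) ^+ 2 * t / ((y + t) * (1 + y * t)) in
  let T := (y + t) / (1 + y * t) in
  (exists L R : fps (fps Qyz),
    [/\ fps2_sum 1 (fun n =>
           (1 + y * t) ^+ n / (1 - t) ^+ n.+1
           * P_lpk_des_fix n Y T z * x ^+ n) L,
         fps2_sum 0 (fun k =>
           (1 + z * x * y) ^+ k / (1 - z * x) ^+ k.+1
           * ((1 - x) ^+ k.+1 / (1 + x * y) ^+ k)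
           * (t ^+ k / (1 - (k%:R * (1 + y) + 1) * x))) R
       & 1 / (1 - t) + L = R])
  /\
  (exists L R : fps (fps Qyz),
    [/\ fps2_sum 1 (fun n =>
           (1 + y * t) ^+ n / (1 - t) ^+ n.+1
           * D_lpk_des n Y T * x ^+ n) L,
         fps2_sum 0 (fun k =>
           (1 - x) ^+ k.+1 / (1 + x * y) ^+ k
           * (t ^+ k / (1 - (k%:R * (1 + y) + 1) * x))) R
       & 1 / (1 - t) + L = R]).
Proof.
move=> x t y z Y T; split; first exact: (lpk_des_fix_series (tofrac 'X) y_unit).
exact: (lpk_des_derangement_series y_unit).
Qed.
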